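(* Let $p$ be an odd prime. Let $s\in\mathbb{Z}_p$ with $s\neq 1$ and let $a\in\mathbb{C}_p$ with $|a|_p>1$. Then $\zeta_{p,E}(s,a)$ formally satisfies the infinite order linear differential equation $$T_p^a\left[\zeta_{p,E}(s,a)-\langle a\rangle^{1-s}\right]=\frac{1}{s-1}\left(\langle a-1\rangle^{1-s}-\langle a\rangle^{1-s}\right),$$ where ''formally'' means that in $T_p^a=\sum_{n=0}^\infty P_{p,n}^a(s)\exp_p(nD)$ each operator $\exp_p(nD)$ ($n\ge 0$) is interpreted, through the formal Taylor expansion in $n$, as the shift $\exp_p(nD)f(s)=f(s+n)$.
   Context: $p$ is an odd prime, $\mathbb{C}_p$ is the completion of an algebraic closure of $\mathbb{Q}_p$, with $|p|_p=1/p$ and valuation $v_p$, so $|x|_p=p^{-v_p(x)}$. Projections: fix an embedding of $\overline{\mathbb{Q}}$ into $\mathbb{C}_p$; for $r\in\mathbb{Q}$ let $p^r\in\mathbb{C}_p^\times$ denote the image of the positive real number $p^r$. Let $\mu$ be the group of roots of unity in $\mathbb{C}_p$ of order prime to $p$. For $|a|_p=1$, $\hat a\in\mu$ is the unique element with $|a-\hat a|_p<1$; for general $a\in\mathbb{C}_p^\times$, $\hat a:=\widehat{a/p^{v_p(a)}}$. Put $\omega_v(a)=p^{v_p(a)}\hat a$ and $\langle a\rangle=a/\omega_v(a)$, so that $|\langle a\rangle-1|_p<1$. For $s\in\mathbb{C}_p$, $\langle a\rangle^s=\sum_{n=0}^\infty\binom{s}{n}(\langle a\rangle-1)^n$ whenever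 this converges (in particular for $s\in\mathbb{Z}_p$). Zeta function: for $a\in\mathbb{C}_p\setminus\mathbb{Z}_p$, the $p$-adic Hurwitz-type Euler zeta function is $$\zeta_{p,E}(s,a)=\int_{\mathbb{Z}_p}\langle a+t\rangle^{1-s}\,d\mu_{-1}(t),\qquad \int_{\mathbb{Z}_p}f(t)\,d\mu_{-1}(t):=\lim_{r\to\infty}\sum_{k=0}^{p^r-1}f(k)(-1)^k .$$ Operator: $T_p^a=\sum_{n=0}^\infty L_{p,n}^a$ with $L_{p,n}^a=P_{p,n}^a(s)\exp_p(nD)$, where $$P_{p,0}^a(s)=\frac{2}{s-1},\quad P_{p,1}^a(s)=\frac{1}{\omega_v(a)},\quad P_{p,n}^a(s)=\frac{1}{n!\,\omega_v^n(a)}\prod_{j=1}^{n-1}(s-1+j)\ (n\ge2),$$ $\omega_v^n(a)=\omega_v(a)^n$, and $\exp_p(nD)=\mathrm{id}+\sum_{k=1}^\infty\frac{n^k}{k!}D_s^k$ with $D_s^k=\frac{\partial^k}{\partial s^k}$. *)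

(* Defs.v *)
From HB Require Import structures.
From mathcomp Require Import all_boot all_order all_algebra all_field.
From mathcomp Require Import all_classical all_reals all_analysis.

Set Implicit Arguments.
Unset Strict Implicit.
Unset Printing Implicit Defensive.

Import Order.TTheory GRing.Theory Num.Theory.

Local Open Scope classical_set_scope.
Local Open Scope ring_scope.

(* A bare join, with no compatibility required between the field operations and
   the uniformity: that is part of [isPadicComplex]. The normed types of the
   library do not apply to C_p, as their scalars carry the archimedean norm. *)
#[short(type="uniformFieldType")]
HB.structure Definition UniformField := {K of GRing.Field K & Uniform K}.

(* Q_p as a subset of a complete field K with |p| = 1/p: the closure of the
   rationals is then their p-adic completion. *)
Definition Qpadic (K : uniformFieldType) : set K := closure (range (ratr : rat -> K)).

(* The elements of K that are algebraic over Q_p. *)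
Definition Qpadic_bar (K : uniformFieldType) : set K :=
  [set x | exists q : {poly K}, [/\ q != 0, forall i, Qpadic q`_i & root q x]].

(* K is the completion of an algebraic closure of Q_p: it is complete for a
   nonarchimedean absolute value with |p| = 1/p, and the subfield of elements
   algebraic over Q_p is algebraically closed and dense in K. *)
HB.mixin Record isPadicComplex (R : realType) (p : nat) K of UniformField K := {
  pabs : K -> R ;
  pabs_ge0 : forall x, 0 <= pabs x ;
  pabs_eq0 : forall x, pabs x = 0 <-> x = 0 ;
  pabsM : forall x y, pabs (x * y) = pabs x * pabs y ;
  pabsD : forall x y, pabs (x + y) <= Num.max (pabs x) (pabs y) ;
  pabs_p : pabs p%:R = p%:R^-1 ;
  pabs_entourage : forall E : set (K * K), entourage E <->
    exists2 e : R, 0 < e & forall x y, pabs (x - y) < e -> E (x, y) ;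
  padic_complete : forall F : set_system K,
    ProperFilter F -> cauchy F -> exists l : K, F --> l ;
  Qpadic_bar_closed : forall q : {poly K}, (1 < size q)%N ->
    (forall i, @Qpadic_bar K q`_i) -> exists2 x, @Qpadic_bar K x & root q x ;
  Qpadic_bar_dense : closure (@Qpadic_bar K) = setT
}.

#[short(type="padicComplexType")]
HB.structure Definition PadicComplex (R : realType) (p : nat) :=
  {K of isPadicComplex R p K & UniformField K}.

(* The positive real number x ^ r, for 0 < x. *)
Definition algC_ratpow (x : algC) (r : rat) : algC :=
  (`|denq r|%N.-root x) ^ numq r.

Section HurwitzEuler.
Variables (R : realType) (p : nat) (K : padicComplexType R p).
Variable iota : {rmorphism algC -> K}.
Implicit Types (a s x y : K) (n : nat).

Definition Zpadic : set K := @Qpadic K `&` [set x | pabs x <= 1].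

(* Limit of a sequence, 0 when there is none ([lim] needs a pointed type). *)
Definition plim (u : nat -> K) : K := xget 0 [set l | u @ \oo --> l].

(* p ^ r in K, through the fixed embedding of the algebraic numbers *)
Definition ppow (r : rat) : K := iota (algC_ratpow p%:R r).

(* The valuation: it is rational-valued on nonzero elements; the value at 0 is
   irrelevant. *)
Definition vp x : rat := xget 0 [set r : rat | pabs x = p%:R `^ (- ratr r)].

(* Roots of unity of order prime to p *)
Definition mu : set K :=
  [set z | exists n, [/\ (0 < n)%N, coprime n p & z ^+ n = 1]].

(* x |-> \hat x, first for |x| = 1, then ([teich]) for x != 0. *)
Definition teich1 x : K := xget 0 [set z | mu z /\ pabs (x - z) < 1].

Definition teich a : K := teich1 (a / ppow (vp a)).

Definition omegav a : K := ppow (vp a) * teich a.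

Definition angle a : K := a / omegav a.

Definition binomK s n : K := (\prod_(i < n) (s - i%:R)) / n`!%:R.

(* <a> ^ s *)
Definition anglepow a s : K :=
  plim (series (fun n => binomK s n * (angle a - 1) ^+ n)).

(* Integral over Z_p with respect to mu_{-1} *)
Definition fermionic_int (f : K -> K) : K :=
  plim (fun r => \sum_(0 <= k < p ^ r) f k%:R * (-1) ^+ k).

Definition zetaE s a : K := fermionic_int (fun t => anglepow (a + t) (1 - s)).

Definition Pcoef a n s : K :=
  match n with
  | 0 => 2%:R / (s - 1)
  | 1 => (omegav a)^-1
  | _ => (n`!%:R * omegav a ^+ n)^-1 * \prod_(1 <= j < n) (s - 1 + j%:R)
  end.

(* exp_p(nD), interpreted through formal Taylor expansion as a shift *)
Definition expD n (f : K -> K) : K -> K := fun s => f (s + n%:R).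

Definition Lop a n (f : K -> K) : K -> K := fun s => Pcoef a n s * expD n f s.

(* T_p^a [f] (s) = y: the series defining the left side converges to y. *)
Definition Tp_eq a (f : K -> K) s y : Prop :=
  series (fun n => Lop a n f s) @ \oo --> y.

End HurwitzEuler.

(* Main.v *)
Require Import Defs.
From mathcomp Require Import all_boot all_order all_algebra all_field.
From mathcomp Require Import all_classical all_reals all_analysis.
From mathcomp Require Import ring zify.
Import Order.TTheory GRing.Theory Num.Theory.
Local Open Scope classical_set_scope.
Local Open Scope ring_scope.

(** Write [I(f)] for the fermionic integral. For [|t| <= 1 < |a|] the elements
    [a + t] and [a] have the same [omegav], say [w], so [<a + t> = (a + t) / w].
    Up to the factor [s - 1], the coefficient [P_n(s)] is the nth term of the
    binomial series of [(1 - 1 / w) ^ (1 - s)], except that [P_0] contributes 2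
    instead of 1. Since
    [<a + t> ^ (1 - s - n) = <a + t> ^ (1 - s) (w / (a + t)) ^ n], summing
    over [n] under the integral sign produces
    [<a + t> ^ (1 - s) (1 - 1 / (a + t)) ^ (1 - s) = <a + t - 1> ^ (1 - s)].
    With [f(t) = <a + t> ^ (1 - s)] the operator therefore sends the zeta
    function to [I(f(. - 1)) + I(f)], divided by [s - 1], and the integrals add
    up to [2 f(- 1)] by the functional equation of [I] ([fermionic_shift]). In
    the same way the subtracted power [<a> ^ (1 - s)] is sent to
    [f(- 1) + f(0)], divided by [s - 1]. The difference is the right-hand side.

    Sum and integral can be exchanged because truncating the binomial series
    after [N] terms makes an error of at most [|a| ^ (- N)], uniformly in [t]
    ([truncation_error]), and alternating sums do not increase such a bound.

    Two facts carry the analysis. A p-adic integer exponent is a limit of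
    natural numbers, and the sum of a binomial series is the corresponding limit
    of ordinary powers ([binser_lim]); multiplicativity and the Lipschitz
    estimate of the powers are inherited from there. And [omegav] makes sense:
    the absolute values of [K] are rational powers of [p] ([vp_exists]), and
    every element of absolute value 1 is close to a root of unity of order prime
    to [p] ([mu_near]). Both come from the density of the elements algebraic
    over Q_p. *)

(** * The absolute value *)

Section PadicAbs.
Context {R : realType} {p : nat} (p_prime : prime p) {K : padicComplexType R p}.
Implicit Types (x y z s l : K) (u v : nat -> K).

Lemma pabs0 : pabs (0 : K) = 0.
Proof. exact/pabs_eq0. Qed.

Lemma pabs_gt0 x : (0 < pabs x) = (x != 0).
Proof.
rewrite lt_neqAle pabs_ge0 andbT eq_sym; congr (~~ _).
by apply/eqP/eqP => /pabs_eq0.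
Qed.

Lemma pabs1 : pabs (1 : K) = 1.
Proof.
have n0 : pabs (1 : K) != 0 by rewrite gt_eqF // pabs_gt0 oner_eq0.
by apply: (mulfI n0); rewrite -pabsM !mulr1.
Qed.

Lemma pabsX x n : pabs (x ^+ n) = pabs x ^+ n.
Proof. by elim: n => [|n IH]; rewrite ?expr0 ?pabs1 // !exprS pabsM IH. Qed.

Lemma pabs_unity x n : (0 < n)%N -> x ^+ n = 1 -> pabs x = 1.
Proof.
move=> n0 xn; apply/eqP; rewrite -(pexpr_eq1 n0 (pabs_ge0 x)) -pabsX xn.
by rewrite pabs1.
Qed.

Lemma pabsN x : pabs (- x) = pabs x.
Proof.
by rewrite -mulN1r pabsM (@pabs_unity (-1) 2) ?mul1r // sqrrN expr1n.
Qed.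

Lemma pabsV x : pabs x^-1 = (pabs x)^-1.
Proof.
have [->|x0] := eqVneq x 0; first by rewrite invr0 pabs0 invr0.
have n0 : pabs x != 0 by rewrite gt_eqF // pabs_gt0.
by apply: (mulfI n0); rewrite -pabsM !divff // pabs1.
Qed.

Lemma pabsXz x (k : int) : pabs (x ^ k) = pabs x ^ k.
Proof. by case: k => n; rewrite ?NegzE -?exprnN -?exprnP ?pabsV pabsX. Qed.

Lemma pabs_distC x y : pabs (x - y) = pabs (y - x).
Proof. by rewrite -pabsN opprB. Qed.

Lemma pabsD_le x y C : pabs x <= C -> pabs y <= C -> pabs (x + y) <= C.
Proof. by move=> xC yC; rewrite (le_trans (pabsD x y))// ge_max xC. Qed.

Lemma pabsD_lt x y C : pabs x < C -> pabs y < C -> pabs (x + y) < C.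
Proof. by move=> xC yC; rewrite (le_lt_trans (pabsD x y))// gt_max xC. Qed.

Lemma pabsB_le x y C : pabs x <= C -> pabs y <= C -> pabs (x - y) <= C.
Proof. by move=> xC yC; apply: pabsD_le; rewrite ?pabsN. Qed.

Lemma pabsB_lt x y C : pabs x < C -> pabs y < C -> pabs (x - y) < C.
Proof. by move=> xC yC; apply: pabsD_lt; rewrite ?pabsN. Qed.

Lemma pabs_dist_lt y x z C :
  pabs (x - y) < C -> pabs (y - z) < C -> pabs (x - z) < C.
Proof. by move=> xy yz; rewrite -(subrKA y); apply: pabsD_lt. Qed.

Lemma pabs_dist_le y x z C :
  pabs (x - y) <= C -> pabs (y - z) <= C -> pabs (x - z) <= C.
Proof. by move=> xy yz; rewrite -(subrKA y); apply: pabsD_le. Qed.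

Lemma pabs_sum_le (I : Type) (r : seq I) (P : pred I) (F : I -> K) C :
  0 <= C -> (forall i, P i -> pabs (F i) <= C) ->
  pabs (\sum_(i <- r | P i) F i) <= C.
Proof.
move=> C0 FC; elim/big_ind: _ => //; first by rewrite pabs0.
by move=> x y; exact: pabsD_le.
Qed.

Lemma pabs_sum_lt (I : Type) (r : seq I) (P : pred I) (F : I -> K) C :
  0 < C -> (forall i, P i -> pabs (F i) < C) ->
  pabs (\sum_(i <- r | P i) F i) < C.
Proof.
move=> C0 FC; elim/big_ind: _ => //; first by rewrite pabs0.
by move=> x y; exact: pabsD_lt.
Qed.

(** If [|x + y|] were smaller than [|x|], then so would be [|(x + y) - y|]. So
    the absolute value is locally constant away from zero. *)
Lemma pabsD_eq x y : pabs y < pabs x -> pabs (x + y) = pabs x.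
Proof.
move=> yx; apply/eqP; rewrite eq_le pabsD_le ?(ltW yx) //=.
rewrite leNgt; apply/negP => xyx.
by have := pabsB_lt _ _ _ xyx yx; rewrite addrK ltxx.
Qed.

Lemma pabs_near x y : pabs (x - y) < pabs x -> pabs y = pabs x.
Proof.
move=> xy; rewrite -[in LHS](subKr x y) pabsD_eq // pabsN //.
Qed.

Lemma pabs_mulB x y z t : pabs x <= 1 -> pabs t <= 1 ->
  pabs (x * y - z * t) <= Num.max (pabs (x - z)) (pabs (y - t)).
Proof.
move=> x1 t1.
have -> : x * y - z * t = x * (y - t) + (x - z) * t.
  by rewrite mulrBr mulrBl subrKA.
by apply: pabsD_le; rewrite pabsM le_max;
  [rewrite orbC ler_piMl | rewrite ler_piMr]; rewrite ?pabs_ge0.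
Qed.

Lemma pabsX_dist x y n : pabs x <= 1 -> pabs y <= 1 ->
  pabs (x ^+ n - y ^+ n) <= pabs (x - y).
Proof.
move=> x1 y1; elim: n => [|n IH]; first by rewrite subrr pabs0 pabs_ge0.
rewrite !exprSr (le_trans (pabs_mulB _ _ _ _ _ y1)) ?ge_max ?IH ?lexx //.
by rewrite pabsX exprn_ile1 ?pabs_ge0.
Qed.

(** * Absolute values of integers *)

Lemma pabs_nat_le1 n : pabs (n%:R : K) <= 1.
Proof.
by elim: n => [|n IH]; rewrite ?pabs0 ?ler01 // mulrSr pabsD_le ?pabs1.
Qed.

Lemma pabs_int_le1 (k : int) : pabs (k%:~R : K) <= 1.
Proof. by case: k => n; rewrite ?NegzE ?mulrNz ?pabsN pabs_nat_le1. Qed.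

Lemma pinv_lt1 : p%:R^-1 < 1 :> R.
Proof. by rewrite invf_lt1 ?ltr0n ?ltr1n ?prime_gt1 ?prime_gt0. Qed.

(** A Bezout relation writes 1 as a multiple of [p] plus a multiple of [n], and
    these cannot both be small. *)
Lemma pabs_nat_coprime n : coprime p n -> pabs (n%:R : K) = 1.
Proof.
move=> pn; apply/eqP; rewrite eq_le pabs_nat_le1 leNgt /=; apply/negP => n1.
have [a b ab _] := egcdnP n (prime_gt0 p_prime).
have : pabs (1 : K) < 1.
  have -> : 1 = (a * p)%:R - (b * n)%:R :> K.
    by rewrite ab (eqP pn) natrD addrC addKr.
  have Hlt (c d : nat) : pabs (d%:R : K) < 1 -> pabs ((c * d)%:R : K) < 1.
    move=> d1; rewrite natrM pabsM (le_lt_trans _ d1) //.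
    by rewrite ler_piMl ?pabs_ge0 ?pabs_nat_le1.
  by apply: pabsB_lt; apply: Hlt => //; rewrite pabs_p pinv_lt1.
by rewrite pabs1 ltxx.
Qed.

Lemma pabs_nat n : (0 < n)%N -> pabs (n%:R : K) = p%:R^-1 ^+ logn p n.
Proof.
move=> n0; have [m pm nE] := pfactor_coprime p_prime n0.
by rewrite [in LHS]nE natrM natrX pabsM pabsX pabs_p pabs_nat_coprime ?mul1r.
Qed.

Lemma natr_neq0 n : (0 < n)%N -> n%:R != 0 :> K.
Proof.
move=> n0; rewrite -pabs_gt0 pabs_nat // exprn_gt0 // invr_gt0 ltr0n.
exact: prime_gt0.
Qed.

Lemma pabs_int (k : int) : k != 0 ->
  pabs (k%:~R : K) = p%:R^-1 ^+ logn p `|k|%N.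
Proof.
move=> k0; rewrite -pabs_nat ?absz_gt0 //.
case: (intP k) => [|n|n]; rewrite ?abszN ?absz_nat ?mulrNz ?pabsN //.
Qed.

Lemma pabs_dvd n k : (n %| k)%N -> pabs (k%:R : K) <= pabs (n%:R : K).
Proof.
move=> /dvdnP[m ->]; rewrite natrM pabsM ler_piMl ?pabs_ge0 //.
exact: pabs_nat_le1.
Qed.

(** * Limits in the metric of the absolute value *)

Lemma cvg_pabsP u l : u @ \oo --> l <->
  forall e, 0 < e -> exists N, forall n, (N <= n)%N -> pabs (u n - l) < e.
Proof.
split.
  move=> ul e e0.
  pose E : set (K * K) := [set xy | pabs (xy.1 - xy.2) < e].
  have entE : entourage E by apply/pabs_entourage; exists e.
  have /cvg_entourageP /(_ E entE) := ul.
  move=> [N _ NE]; exists N => n Nn; rewrite pabs_distC; exact: (NE n Nn).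
move=> H; apply/cvg_entourageP => A /pabs_entourage[e e0 eA].
have [N NE] := H e e0; exists N => // n Nn /=; apply: eA.
by rewrite pabs_distC; exact: NE.
Qed.

Lemma closure_pabsP (A : set K) x : closure A x <->
  forall e, 0 < e -> exists2 y, A y & pabs (x - y) < e.
Proof.
split.
  move=> Ax e e0.
  pose E : set (K * K) := [set xy | pabs (xy.1 - xy.2) < e].
  have entE : entourage E by apply/pabs_entourage; exists e.
  have [y [Ay]] := Ax _ (nbhs_entourage x entE).
  by rewrite /xsection /= inE; exists y.
move=> H B /nbhsP[E /pabs_entourage[e e0 eE] EB].
have [y Ay xy] := H e e0; exists y; split => //; apply: EB.
by rewrite /xsection /= inE; exact: eE.
Qed.

(** In an ultrametric space a sequence is Cauchy as soon as its consecutive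
    differences tend to zero. *)
Lemma pabs_complete u :
  (forall e, 0 < e -> exists N, forall n, (N <= n)%N ->
     pabs (u n.+1 - u n) < e) ->
  exists l : K, u @ \oo --> l.
Proof.
move=> H; apply: (@padic_complete R p K (fmap u eventually)).
move=> E /pabs_entourage[e e0 eE].
have [N NE] := H e e0.
have tail n : (N <= n)%N -> pabs (u n - u N) < e.
  elim: n => [|n IH]; first by rewrite leqn0 => /eqP->; rewrite subrr pabs0.
  rewrite leq_eqVlt => /predU1P[->|]; first by rewrite subrr pabs0.
  rewrite ltnS => Nn; apply: (@pabs_dist_lt (u n)); first exact: NE.
  exact: IH.
exists (u @` [set n | (N <= n)%N], u @` [set n | (N <= n)%N]).
  by split; exists N => // n /= Nn; exists n.
move=> [x y] /= [[n Nn <-] [m Nm <-]]; apply: eE.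
by apply: (@pabs_dist_lt (u N)); rewrite ?tail // pabs_distC tail.
Qed.

Lemma pabs_lt_all_eq x y : (forall e, 0 < e -> pabs (x - y) < e) -> x = y.
Proof.
move=> H; apply/eqP; rewrite -subr_eq0 -[_ == 0]negbK -pabs_gt0.
by apply/negP => /H; rewrite ltxx.
Qed.

Lemma cvg_pabs_unique u l (m : K) : u @ \oo --> l -> u @ \oo --> m -> l = m.
Proof.
move=> /cvg_pabsP ul /cvg_pabsP um; apply: pabs_lt_all_eq => e e0.
have [N NE] := ul e e0; have [M ME] := um e e0.
apply: (@pabs_dist_lt (u (maxn N M))).
  by rewrite pabs_distC NE // leq_maxl.
by rewrite ME // leq_maxr.
Qed.

Lemma plim_cvg u l : u @ \oo --> l -> plim u = l.
Proof. by move=> ul; apply: xget_unique => // m /cvg_pabs_unique; exact. Qed.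

Lemma cvg_sub0 u l : u @ \oo --> l <-> (fun n => u n - l) @ \oo --> (0 : K).
Proof.
by split=> /cvg_pabsP H; apply/cvg_pabsP => e /H[N NE]; exists N => n /NE;
  rewrite subr0.
Qed.

Lemma cvg_pabs_cst (c : K) : (fun _ : nat => c) @ \oo --> c.
Proof. exact: cvg_cst. Qed.

Lemma cvg_pabsD u v l (m : K) : u @ \oo --> l -> v @ \oo --> m ->
  (fun n => u n + v n) @ \oo --> l + m.
Proof.
move=> /cvg_pabsP ul /cvg_pabsP vm; apply/cvg_pabsP => e e0.
have [N NE] := ul e e0; have [M ME] := vm e e0.
exists (maxn N M) => n; rewrite geq_max => /andP[Nn Mn].
by rewrite opprD addrACA; apply: pabsD_lt; [exact: NE|exact: ME].
Qed.

Lemma cvg_pabsMl c u l : u @ \oo --> l -> (fun n => c * u n) @ \oo --> c * l.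
Proof.
move=> /cvg_pabsP ul; apply/cvg_pabsP => e e0.
have c1 : 0 < pabs c + 1 by rewrite ltr_wpDl ?pabs_ge0.
have [N NE] := ul (e / (pabs c + 1)) (divr_gt0 e0 c1).
exists N => n /NE; rewrite -mulrBr pabsM ltr_pdivlMr // mulrC.
by apply: le_lt_trans; rewrite ler_wpM2r ?pabs_ge0 // lerDl.
Qed.

Lemma cvg_pabsB u v l (m : K) : u @ \oo --> l -> v @ \oo --> m ->
  (fun n => u n - v n) @ \oo --> l - m.
Proof.
move=> ul vm; rewrite -mulN1r (_ : (fun n => _) = fun n => u n + -1 * v n).
  by apply: cvg_pabsD => //; exact: cvg_pabsMl.
by apply/funext => n; rewrite mulN1r.
Qed.

Lemma cvg_pabsM u v l (m : K) : u @ \oo --> l -> v @ \oo --> m ->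
  (fun n => u n * v n) @ \oo --> l * m.
Proof.
move=> ul vm.
have -> : l * m = (0 + l * m) + m * 0 by rewrite add0r mulr0 addr0.
have uv0 : (fun n => (u n - l) * (v n - m)) @ \oo --> (0 : K).
  move/cvg_sub0/cvg_pabsP: ul => ul; move/cvg_sub0/cvg_pabsP: vm => vm.
  apply/cvg_pabsP => e e0.
  have [N NE] := ul e e0; have [M ME] := vm 1 ltr01.
  exists (maxn N M) => n; rewrite geq_max => /andP[/NE + /ME].
  rewrite !subr0 pabsM => ue v1.
  by rewrite (le_lt_trans _ ue) // ler_piMr ?pabs_ge0 // ltW.
have := cvg_pabsD _ _ _ _ (cvg_pabsD _ _ _ _ uv0 (cvg_pabsMl l _ _ vm))
  (cvg_pabsMl m _ _ (proj1 (cvg_sub0 _ _) ul)).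
apply: cvg_trans; apply: near_eq_cvg; apply: nearW => n.
by rewrite mulrBl [l * v n]mulrC [m * _]mulrC mulrBr mulrBl; ring.
Qed.

Lemma cvg_pabs_sum (I : Type) (r : seq I) (u : I -> nat -> K) (l : I -> K) :
  (forall i, u i @ \oo --> l i) ->
  (fun n => \sum_(i <- r) u i n) @ \oo --> \sum_(i <- r) l i.
Proof.
move=> ul; elim: r => [|i r IH].
  rewrite big_nil (_ : (fun n => _) = fun=> 0) //; first exact: cvg_cst.
  by apply/funext => n; rewrite big_nil.
rewrite big_cons (_ : (fun n => _) = fun n => u i n + \sum_(j <- r) u j n).
  exact: cvg_pabsD.
by apply/funext => n; rewrite big_cons.
Qed.

(** If [|l|] exceeded [C], the terms close to [l] would have the absolute value
    of [l]. *)
Lemma cvg_pabs_le u l C N : u @ \oo --> l ->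
  (forall n, (N <= n)%N -> pabs (u n) <= C) -> pabs l <= C.
Proof.
move=> /cvg_pabsP ul uC; rewrite leNgt; apply/negP => Cl.
have C0 : 0 <= C by rewrite (le_trans _ (uC N _)) ?pabs_ge0.
have [M ME] := ul (pabs l) (le_lt_trans C0 Cl).
have := ME _ (leq_maxr N M); rewrite pabs_distC => /pabs_near unl.
by have := uC _ (leq_maxl N M); rewrite unl leNgt Cl.
Qed.

Lemma geometric_small (c e : R) : 0 <= c -> c < 1 -> 0 < e ->
  exists N, forall n, (N <= n)%N -> c ^+ n < e.
Proof.
move=> c0 c1 e0.
have /cvgrPdist_lt /(_ e e0)[N _ NE] : c ^+ n @[n --> \oo] --> 0.
  by apply: cvg_expr; rewrite ger0_norm.
exists N => n /NE /=; rewrite sub0r normrN ger0_norm //.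
exact: exprn_ge0.
Qed.
End PadicAbs.

(** * The p-adic integers as limits of natural numbers *)

Section BinomialSeries.
Context {R : realType} {p : nat} (p_prime : prime p) {K : padicComplexType R p}.
Implicit Types (x y z s l : K) (n : nat) (e : R).

(** The closure of the natural numbers. P-adic integer exponents enter the
    proofs in this form, which lets powers be computed as limits of ordinary
    ones and is stable under the shifts of [s] that the operator performs. *)
Definition nat_approximable s :=
  forall e, 0 < e -> exists m : nat, pabs (s - m%:R) < e.

Lemma ppow_small e : 0 < e ->
  exists N, forall n, (N <= n)%N -> p%:R^-1 ^+ n < e.
Proof.
by move=> e0; apply: geometric_small; rewrite ?invr_ge0 ?ler0n ?pinv_lt1.
Qed.

Lemma pabs_pX n : pabs ((p ^ n)%:R : K) = p%:R^-1 ^+ n.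
Proof. by rewrite natrX pabsX pabs_p. Qed.

(** An integer is close to its remainder modulo a high power of [p]. *)
Lemma int_nat_approximable (k : int) : nat_approximable k%:~R.
Proof.
move=> e e0; have [N /(_ N (leqnn N)) NE] := ppow_small e e0.
have P0 : (p ^ N)%:Z != 0 by rewrite eqz_nat -lt0n expn_gt0 prime_gt0.
exists `|(k %% (p ^ N)%:Z)%Z|%N.
have -> : (`|(k %% (p ^ N)%:Z)%Z|%N)%:R = (k %% (p ^ N)%:Z)%Z%:~R :> K.
  by rewrite -[in RHS](gez0_abs (modz_ge0 k P0)).
rewrite [in X in X - _](divz_eq k (p ^ N)%:Z) rmorphD /= addrK.
rewrite rmorphM /= pabsM (le_lt_trans _ NE) // -pabs_pX.
by rewrite ler_piMl ?pabs_ge0 ?pabs_int_le1.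
Qed.

Lemma nat_approximable_near s :
  (forall e, 0 < e -> exists2 t, nat_approximable t & pabs (s - t) < e) ->
  nat_approximable s.
Proof.
move=> H e e0; have [t tN st] := H e e0; have [m tm] := tN e e0.
by exists m; exact: (pabs_dist_lt t).
Qed.

(** In a Bezout relation [u d + w p ^ M = p ^ k] for the gcd, [p ^ k] divides
    [d]. As [|c| <= |d|], it divides [c], and so [c] is a multiple of [d] up to
    a multiple of [p ^ M]. *)
Lemma intfrac_nat_approximable (c d : int) : d != 0 ->
  pabs (c%:~R : K) <= pabs (d%:~R : K) -> nat_approximable (c%:~R / d%:~R).
Proof.
move=> d0 cd; apply: nat_approximable_near => e e0.
have dK0 : 0 < pabs (d%:~R : K).
  by rewrite pabs_int // exprn_gt0 // invr_gt0 ltr0n prime_gt0.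
have [M /(_ M (leqnn M)) ME] := ppow_small _ (mulr_gt0 e0 dK0).
have [u [w uw]] := Bezoutz d (p ^ M)%:Z.
have /dvdn_pfactor : (`|gcdz d (p ^ M)%:Z| %| p ^ M)%N by exact: dvdn_gcdr.
move=> /(_ p_prime)[k kM gE].
have gZ : gcdz d (p ^ M)%:Z = (p ^ k)%:Z by rewrite -gE gez0_abs.
have /dvdzP[c' cE] : (gcdz d (p ^ M)%:Z %| c)%Z.
  rewrite gZ; have [->|c0] := eqVneq c 0; first exact: dvdz0.
  rewrite dvdzE absz_nat pfactor_dvdn ?absz_gt0 //.
  have : pabs (c%:~R : K) <= p%:R^-1 ^+ k.
    rewrite (le_trans cd) // -pabs_pX.
    have /dvdzP[d' ->] : ((p ^ k)%:Z %| d)%Z by rewrite -gZ dvdz_gcdl.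
    by rewrite rmorphM pabsM ler_piMl ?pabs_ge0 ?pabs_int_le1.
  rewrite pabs_int // leNgt; apply: contraNT; rewrite -ltnNge => ck.
  by rewrite ltr_iXn2l // ?pinv_lt1 // invr_gt0 ltr0n prime_gt0.
exists (c' * u)%:~R; first exact: int_nat_approximable.
rewrite -(ltr_pM2r dK0) -pabsM mulrBl divfK -?pabs_gt0 // (le_lt_trans _ ME) //.
rewrite cE -uw -rmorphM -rmorphB /=.
have -> : c' * (u * d + w * (p ^ M)%:Z) - c' * u * d = c' * w * (p ^ M)%:Z.
  by ring.
by rewrite rmorphM pabsM -pabs_pX ler_piMl ?pabs_ge0 ?pabs_int_le1.
Qed.

(** Rational numbers close to [x] and [y] have a quotient close to [x / y],
    and the one close to [y] has exactly the absolute value of [y]. *)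
Lemma Qpadic_div_nat_approximable x y : Qpadic x -> Qpadic y -> y != 0 ->
  pabs x <= pabs y -> nat_approximable (x / y).
Proof.
move=> xQ yQ y0 xy.
have yp : 0 < pabs y by rewrite pabs_gt0.
apply: nat_approximable_near => e e0.
pose d := pabs y * Num.min e 1.
have m0 : 0 < Num.min e 1 by rewrite lt_min e0 ltr01.
have d0 : 0 < d by rewrite mulr_gt0.
have dy : d <= pabs y by rewrite ler_piMr ?pabs_ge0 // ge_min lexx orbT.
have [_ [q _ <-] xq] := proj1 (closure_pabsP _ _) xQ d d0.
have [_ [r _ <-] yr] := proj1 (closure_pabsP _ _) yQ d d0.
have rE : pabs (ratr r : K) = pabs y by apply: pabs_near; exact: lt_le_trans dy.
have r0 : ratr r != 0 :> K by rewrite -pabs_gt0 rE.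
have qy : pabs (ratr q : K) <= pabs y.
  rewrite -(subKr x (ratr q)); apply: pabsB_le => //.
  by rewrite ltW // (lt_le_trans xq).
exists (ratr q / ratr r).
  have nd (t : rat) : (denq t)%:~R != 0 :> K.
    rewrite -pabs_gt0 pabs_int ?denq_neq0 // exprn_gt0 // invr_gt0 ltr0n.
    exact: prime_gt0.
  have n0 : (numq r)%:~R != 0 :> K.
    by apply: contraNneq r0 => r0; rewrite /ratr r0 mul0r.
  have -> : ratr q / ratr r =
      (numq q * denq r)%:~R / (denq q * numq r)%:~R :> K.
    by rewrite /ratr !rmorphM /= invf_div invfM [LHS]mulrACA.
  apply: intfrac_nat_approximable.
    by rewrite mulf_neq0 ?denq_neq0 //; apply: contraNneq n0 => ->.
  have := qy; rewrite -rE /ratr !rmorphM /= !pabsM !pabsV.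
  rewrite ler_pdivrMr ?pabs_gt0 // mulrAC ler_pdivlMr ?pabs_gt0 //.
  by rewrite [pabs _ * pabs (numq r)%:~R]mulrC.
have -> : x / y - ratr q / ratr r =
    ((x - ratr q) * ratr r - ratr q * (y - ratr r)) / (y * ratr r).
  by field; rewrite y0 r0.
have yr0 : 0 < pabs (y * ratr r) by rewrite pabsM rE mulr_gt0.
rewrite pabsM pabsV ltr_pdivrMr //.
rewrite [pabs (y * _)]pabsM rE.
have de : d * pabs y <= e * (pabs y * pabs y).
  by rewrite mulrAC [leLHS]mulrC ler_wpM2r ?mulr_ge0 ?pabs_ge0 // ge_min lexx.
apply: (lt_le_trans _ de); apply: pabsB_lt; rewrite pabsM.
  by rewrite rE ltr_pM2r.
rewrite mulrC; apply: (@lt_le_trans _ _ (d * pabs y)) => //.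
have [->|q0] := eqVneq (ratr q : K) 0; first by rewrite pabs0 mulr0 mulr_gt0.
apply: (@lt_le_trans _ _ (d * pabs (ratr q : K))).
  by rewrite ltr_pM2r ?pabs_gt0.
by rewrite ler_pM2l.
Qed.

Lemma Zpadic_nat_approximable s : Zpadic s -> nat_approximable s.
Proof.
move=> [sQ s1]; rewrite -[s]divr1.
apply: Qpadic_div_nat_approximable => //; rewrite ?oner_eq0 ?pabs1 //.
by apply: subset_closure; exists 1 => //; rewrite /ratr divr1.
Qed.

Lemma nat_approximable_shift s (k : int) :
  nat_approximable s -> nat_approximable (k%:~R - s).
Proof.
move=> sN; apply: nat_approximable_near => e /sN[m sm].
exists (k - m%:Z)%:~R; first exact: int_nat_approximable.
by rewrite rmorphB /= opprB addrC subrKA pabs_distC.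
Qed.

Lemma nat_approximable_seq s : nat_approximable s ->
  exists m : nat -> nat, (fun k => (m k)%:R : K) @ \oo --> s.
Proof.
move=> sN.
have /choice[m mE] : forall k, exists m : nat, pabs (s - m%:R) < p%:R^-1 ^+ k.
  by move=> k; apply: sN; rewrite exprn_gt0 // invr_gt0 ltr0n prime_gt0.
exists m; apply/cvg_pabsP => e e0.
have [N NE] := ppow_small e e0; exists N => n /NE.
by rewrite pabs_distC; apply: lt_trans.
Qed.

(** * Binomial series with p-adic integer exponent *)

Lemma binomK_nat m n : binomK (m%:R : K) n = 'C(m, n)%:R.
Proof.
rewrite /binomK; suff -> : \prod_(i < n) (m%:R - i%:R) = (m ^_ n)%:R :> K.
  apply: (canLR (mulfK (natr_neq0 p_prime _ (fact_gt0 n)))).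
  by rewrite -natrM bin_ffact.
elim: n => [|n IH]; first by rewrite big_ord0 ffactn0.
rewrite big_ord_recr /= IH ffactnSr natrM.
have [nm|mn] := leqP n m; first by rewrite natrB.
by rewrite ffact_small ?mul0r.
Qed.

Lemma binomK_cvg (u : nat -> K) s n : u @ \oo --> s ->
  (fun k => binomK (u k) n) @ \oo --> binomK s n.
Proof.
move=> us; rewrite /binomK mulrC (_ : (fun k => _) =
  fun k => (n`!%:R)^-1 * \prod_(i < n) (u k - i%:R)); last first.
  by apply/funext => k; rewrite mulrC.
apply: cvg_pabsMl; elim: n => [|n IH].
  rewrite big_ord0 (_ : (fun k => _) = fun=> 1) //; first exact: cvg_pabs_cst.
  by apply/funext => k; rewrite big_ord0.
rewrite big_ord_recr /= (_ : (fun k => _) =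
  fun k => \prod_(i < n) (u k - i%:R) * (u k - n%:R)); last first.
  by apply/funext => k; rewrite big_ord_recr.
by apply: cvg_pabsM => //; apply: cvg_pabsD => //; exact: cvg_pabs_cst.
Qed.

(** A limit of binomial coefficients of natural numbers. *)
Lemma binomK_le1 s n : nat_approximable s -> pabs (binomK s n) <= 1.
Proof.
move=> /nat_approximable_seq[m ms].
apply: (cvg_pabs_le _ _ _ 0 (binomK_cvg _ _ n ms)) => k _.
by rewrite binomK_nat pabs_nat_le1.
Qed.

(** The power [(1 + x) ^ s]; [anglepow a s] is [binser s (angle a - 1)] by
    conversion. *)
Definition binser s x : K := plim (series (fun n => binomK s n * x ^+ n)).

Lemma binom_term_le s x n : nat_approximable s ->
  pabs (binomK s n * x ^+ n) <= pabs x ^+ n.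
Proof.
by move=> sN; rewrite pabsM pabsX ler_piMl ?exprn_ge0 ?pabs_ge0 ?binomK_le1.
Qed.

Lemma binser_cvg s x : nat_approximable s -> pabs x < 1 ->
  series (fun n => binomK s n * x ^+ n) @ \oo --> binser s x.
Proof.
move=> sN x1; set u := series _.
have [l ul] : exists l : K, u @ \oo --> l.
  apply: pabs_complete => e /(geometric_small _ _ (pabs_ge0 x) x1)[N NE].
  exists N => n /NE; apply: le_lt_trans.
  rewrite /u /series /= big_nat_recr //= [X in pabs X]addrC addKr.
  exact: binom_term_le.
by rewrite /binser (plim_cvg _ _ ul).
Qed.

Lemma binser_tail s x N : nat_approximable s -> pabs x < 1 ->
  pabs (binser s x - \sum_(0 <= n < N) binomK s n * x ^+ n) <= pabs x ^+ N.
Proof.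
move=> sN x1; set S := \sum_(0 <= n < N) _.
apply: (cvg_pabs_le _ _ _ N
  (cvg_pabsD _ _ _ _ (binser_cvg s x sN x1) (cvg_pabs_cst (- S)))) => n Nn.
rewrite /series /= (big_cat_nat _ Nn) //= [X in pabs X]addrC addKr big_nat.
apply: pabs_sum_le; first by rewrite exprn_ge0 ?pabs_ge0.
move=> i /andP[Ni _]; rewrite (le_trans (binom_term_le _ _ _ sN)) //.
by rewrite ler_wiXn2l ?pabs_ge0 // ltW.
Qed.

Lemma binser_nat m x : pabs x < 1 -> binser m%:R x = (1 + x) ^+ m.
Proof.
move=> x1; apply: plim_cvg; apply/cvg_pabsP => e e0.
exists m.+1 => n mn; rewrite /series /= (big_cat_nat _ mn) //=.
rewrite [X in _ + X - _]big_nat.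
rewrite [X in _ + X - _]big1 => [|i /andP[mi _]]; last first.
  by rewrite binomK_nat bin_small ?mul0r.
rewrite addr0 exprDn big_mkord -sumrB big1 ?pabs0 // => i _.
by rewrite expr1n mul1r binomK_nat mulr_natl subrr.
Qed.

(** Since the terms beyond the [N]th contribute at most [|x| ^ N] whatever the
    exponent, the sum of the series is continuous in the exponent. So on the
    p-adic integers it is determined by honest powers. *)
Lemma binser_lim (m : nat -> nat) s x : nat_approximable s -> pabs x < 1 ->
  (fun k => (m k)%:R : K) @ \oo --> s ->
  (fun k => (1 + x) ^+ m k) @ \oo --> binser s x.
Proof.
move=> sN x1 ms; apply/cvg_pabsP => e e0.
have [N /(_ N (leqnn N)) NE] := geometric_small _ _ (pabs_ge0 x) x1 e0.
have /cvg_pabsP /(_ e e0)[M ME] :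
    (fun k => \sum_(0 <= n < N) binomK (m k)%:R n * x ^+ n) @ \oo -->
    \sum_(0 <= n < N) binomK s n * x ^+ n.
  apply: cvg_pabs_sum => n; apply: cvg_pabsM; last exact: cvg_pabs_cst.
  exact: binomK_cvg.
exists M => k /ME; set S := \sum_(0 <= n < N) _; set T := \sum_(0 <= n < N) _.
move=> ST; rewrite -binser_nat //.
apply: (pabs_dist_lt S).
  by apply: le_lt_trans NE; apply: binser_tail => //;
     rewrite -[(m k)%:R]/((m k)%:Z%:~R); exact: int_nat_approximable.
apply: (pabs_dist_lt T) => //.
by rewrite pabs_distC; apply: le_lt_trans NE; exact: binser_tail.
Qed.

Lemma binserM s x y z : nat_approximable s ->
  pabs x < 1 -> pabs y < 1 -> pabs z < 1 -> (1 + x) * (1 + y) = 1 + z ->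
  binser s x * binser s y = binser s z.
Proof.
move=> sN x1 y1 z1 xyz; have [m ms] := nat_approximable_seq _ sN.
have := cvg_pabsM _ _ _ _ (binser_lim _ _ _ sN x1 ms)
  (binser_lim _ _ _ sN y1 ms).
rewrite (_ : (fun k => _) = fun k => (1 + z) ^+ m k); last first.
  by apply/funext => k; rewrite -exprMn xyz.
by move=> /cvg_pabs_unique; apply; exact: binser_lim.
Qed.

Lemma binserD_nat s x n : nat_approximable s -> nat_approximable (s + n%:R) ->
  pabs x < 1 -> binser (s + n%:R) x = binser s x * (1 + x) ^+ n.
Proof.
move=> sN snN x1; have [m ms] := nat_approximable_seq _ sN.
have mn : (fun k => (m k + n)%:R : K) @ \oo --> s + n%:R.
  rewrite (_ : (fun k => _) = fun k => (m k)%:R + n%:R); last first.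
    by apply/funext => k; rewrite natrD.
  by apply: cvg_pabsD => //; exact: cvg_pabs_cst.
apply: cvg_pabs_unique (binser_lim _ _ _ snN x1 mn) _.
rewrite (_ : (fun k => _) = fun k => (1 + x) ^+ m k * (1 + x) ^+ n); last first.
  by apply/funext => k; rewrite exprD.
by apply: cvg_pabsM; [exact: binser_lim|exact: cvg_pabs_cst].
Qed.

Lemma pabs1D_le1 x : pabs x < 1 -> pabs (1 + x) <= 1.
Proof. by move=> x1; apply: pabsD_le; rewrite ?pabs1 // ltW. Qed.

Lemma binser_le1 s x : nat_approximable s -> pabs x < 1 ->
  pabs (binser s x) <= 1.
Proof.
move=> sN x1; have [m ms] := nat_approximable_seq _ sN.
apply: (cvg_pabs_le _ _ _ 0 (binser_lim _ _ _ sN x1 ms)) => k _.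
by rewrite pabsX exprn_ile1 ?pabs_ge0 ?pabs1D_le1.
Qed.

Lemma binser_dist s x y : nat_approximable s -> pabs x < 1 -> pabs y < 1 ->
  pabs (binser s x - binser s y) <= pabs (x - y).
Proof.
move=> sN x1 y1; have [m ms] := nat_approximable_seq _ sN.
apply: (cvg_pabs_le _ _ _ 0 (cvg_pabsB _ _ _ _ (binser_lim _ _ _ sN x1 ms)
  (binser_lim _ _ _ sN y1 ms))) => k _.
rewrite (le_trans (pabsX_dist _ _ _ _ _)) ?pabs1D_le1 //.
by rewrite opprD addrACA subrr add0r.
Qed.
End BinomialSeries.

(** * The values of the absolute value *)

Section ValueGroup.
Context {R : realType} {p : nat} (p_prime : prime p) {K : padicComplexType R p}.
Implicit Types (x y z s l : K) (n : nat) (e : R).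

Lemma p_gt0 : 0 < p%:R :> R.
Proof. by rewrite ltr0n prime_gt0. Qed.

Lemma Qpadic_pabs x : Qpadic x -> x != 0 -> exists k : int, pabs x = p%:R ^ k.
Proof.
move=> xQ x0; have px : 0 < pabs x by rewrite pabs_gt0.
have [_ [q _ <-] /pabs_near xq] := proj1 (closure_pabsP _ _) xQ _ px.
have q0 : q != 0.
  by apply: contraTneq px => q0; rewrite -xq q0 /ratr mul0r pabs0 ltxx.
exists ((logn p `|denq q|)%:Z - (logn p `|numq q|)%:Z).
rewrite -xq /ratr pabsM pabsV !pabs_int ?denq_neq0 ?numq_eq0 //.
by rewrite expfzDr ?gt_eqF ?p_gt0 // !exprVn invrK mulrC -exprnN.
Qed.

(** In a vanishing sum the maximal absolute value is attained twice. *)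
Lemma root_pabs (q : {poly K}) y : q != 0 -> root q y -> y != 0 ->
  exists i j, [/\ (i < j)%N, q`_i != 0, q`_j != 0 &
    pabs (q`_i) * pabs y ^+ i = pabs (q`_j) * pabs y ^+ j].
Proof.
move=> q0 /rootP qy y0.
have y0p : 0 < pabs y by rewrite pabs_gt0.
have sq : (0 < size q)%N by rewrite size_poly_gt0.
pose F (i : 'I_(size q)) := pabs (q`_i * y ^+ i).
have lq : ((size q).-1 < size q)%N by rewrite ltn_predL.
pose l0 := Ordinal lq.
case: (@arg_maxP _ R _ l0 xpredT F isT) => i _ iM.
have {}iM j : F j <= F i by exact: iM.
have Fi0 : 0 < F i.
  apply: lt_le_trans (iM l0); rewrite pabs_gt0 mulf_neq0 ?expf_neq0 //.
  by rewrite -[q`_l0]/(lead_coef q) lead_coef_eq0.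
have [j ji Fj] : exists2 j, j != i & F j = F i.
  apply: contrapT => Hno.
  have Hlt j : j != i -> F j < F i.
    move=> ji; rewrite lt_neqAle iM andbT.
    by apply/eqP => Fji; apply: Hno; exists j.
  have : pabs q.[y] = F i.
    rewrite horner_coef (bigD1 i) //= pabsD_eq //.
    by apply: pabs_sum_lt => // j; exact: Hlt.
  by rewrite qy pabs0 => F0; rewrite -F0 ltxx in Fi0.
have q_neq0 (k : 'I_(size q)) : F k = F i -> q`_k != 0.
  by move=> Fk; apply: contraTneq Fi0 => k0; rewrite -Fk /F k0 mul0r pabs0 ltxx.
have FE (k : 'I_(size q)) : F k = pabs (q`_k) * pabs y ^+ k.
  by rewrite /F pabsM pabsX.
have [ij|ji'|/val_inj ij] := ltngtP i j; last by rewrite ij eqxx in ji.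
  by exists i, j; split; rewrite ?q_neq0 // -!FE.
by exists j, i; split; rewrite ?q_neq0 // -!FE.
Qed.

(** Two terms of equal absolute value in a polynomial relation over Q_p
    express a power of [|x|] as an integral power of [p]; the algebraic numbers
    being dense, they have all the absolute values of [K]. *)
Lemma vp_exists x : x != 0 -> exists r : rat, pabs x = p%:R `^ (- ratr r).
Proof.
move=> x0; have px : 0 < pabs x by rewrite pabs_gt0.
have /closure_pabsP /(_ _ px)[y [q [q0 qQ qy]] /pabs_near yx] :
  closure (@Qpadic_bar K) x by rewrite (@Qpadic_bar_dense R p K).
have y0 : y != 0 by rewrite -pabs_gt0 yx.
have [i [j [ij qi0 qj0 E]]] := root_pabs q y q0 qy y0.
have [k kE] := Qpadic_pabs _ (qQ i) qi0.
have [l lE] := Qpadic_pabs _ (qQ j) qj0.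
have yn : pabs y ^+ (j - i) = p%:R ^ (k - l).
  have pk0 (t : int) : p%:R ^ t != 0 :> R by rewrite expfz_neq0 ?gt_eqF ?p_gt0.
  have yi0 : pabs y ^+ i != 0 by rewrite expf_neq0 // gt_eqF // pabs_gt0.
  apply: (mulfI (pk0 l)); rewrite -expfzDr ?gt_eqF ?p_gt0 // addrC subrK.
  apply: (mulIf yi0).
  by rewrite -mulrA -exprD subnK ?(ltnW ij) // -lE -E kE.
have n0 : (j - i)%:R != 0 :> R by rewrite pnatr_eq0 -lt0n subn_gt0.
exists (- ((k - l)%:~R / (j - i)%:R) : rat).
rewrite rmorphN opprK fmorph_div /= ratr_int ratr_nat powRrM.
rewrite powR_intmul ?ltW ?p_gt0 // -yn -yx -powR_mulrn ?pabs_ge0 //.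
by rewrite -powRrM divff // powRr1 ?pabs_ge0.
Qed.

Lemma vpE x : x != 0 -> pabs x = p%:R `^ (- ratr (vp x)).
Proof. by move=> x0; apply: (xgetPex 0 (vp_exists x x0)). Qed.

(** * Roots of unity of order prime to p *)

(** In the residue field of [K] every element is algebraic over F_p, hence has
    finitely many powers. Inside [K], a relation for [y] lifts to a monic
    polynomial with integral coefficients, the remainders of the ['X^k]
    modulo this polynomial represent the powers of [y] up to an error less than
    1, and these remainders have finitely many classes modulo [p]. *)
Lemma pabs_exp_near1_alg y : Qpadic_bar y -> pabs y = 1 ->
  exists2 N, (0 < N)%N & pabs (y ^+ N - 1) < 1.
Proof.
move=> [q [q0 qQ /rootP qy]] y1.
pose n := size q.
have sq : (0 < n)%N by rewrite size_poly_gt0.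
have ln : (n.-1 < n)%N by rewrite ltn_predL.
pose l0 : 'I_n := Ordinal ln.
case: (@arg_maxP _ R _ l0 xpredT (fun i : 'I_n => pabs q`_i) isT) => i0 _ iM.
set M := pabs q`_i0 in iM.
have {}iM (i : 'I_n) : pabs q`_i <= M by exact: iM.
have M0 : 0 < M.
  apply: lt_le_trans (iM l0); rewrite pabs_gt0.
  by rewrite -[q`_l0]/(lead_coef q) lead_coef_eq0.
have qM i : pabs q`_i <= M.
  have [iq|qi] := ltnP i n; first exact: (iM (Ordinal iq)).
  by rewrite nth_default // pabs0 ltW.
(* Modulo elements less than 1, [q / q`_d] is monic of degree [d] when [d] is
   the last index at which the coefficients attain their maximum. *)
have [d dE dmax] :
    exists2 d, pabs q`_d = M & forall i, (d < i)%N -> pabs q`_i < M.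
  have exM : exists i, pabs q`_i == M by exists i0; exact/eqP.
  have ubM i : pabs q`_i == M -> (i <= n)%N.
    move=> /eqP qiM; rewrite leqNgt; apply/negP => /ltnW ni.
    by rewrite -qiM nth_default // pabs0 ltxx in M0.
  case: (ex_maxnP exM ubM) => d /eqP dE dmax; exists d => // i di.
  rewrite lt_neqAle qM andbT; apply: contraTN di => /dmax.
  by rewrite -leqNgt.
have qd0 : q`_d != 0 by rewrite -pabs_gt0 dE.
have dn : (d < n)%N.
  by rewrite ltnNge; apply: contra qd0 => nd; rewrite nth_default.
have /choice[m mE] : forall i, exists m : nat, pabs (q`_i / q`_d - m%:R) < 1.
  move=> i; have := Qpadic_div_nat_approximable p_prime _ _ (qQ i) (qQ d) qd0.
  by rewrite dE; apply.
pose c i : int := if (i < d)%N then (m i)%:Z else (i == d)%:Z.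
have cE i : pabs (q`_i / q`_d - (c i)%:~R) < 1.
  rewrite /c; case: ltngtP => [id|di|->]; first exact: mE.
    by rewrite subr0 pabsM pabsV dE ltr_pdivrMr // mul1r dmax.
  by rewrite divff // subrr pabs0.
pose P := \poly_(i < n) c i.
have PE : P = 'X^d + \poly_(i < d) (m i)%:Z.
  apply/polyP => i; rewrite coefD coefXn !coef_poly /c.
  case: (ltngtP i d) => [id|di|->]; rewrite ?addr0 ?add0r ?dn //.
    by rewrite (ltn_trans id).
  by case: ifP.
have sP : (size (\poly_(i < d) (m i)%:Z) < size ('X^d : {poly int}))%N.
  by rewrite size_polyXn ltnS size_poly.
have Pmonic : P \is monic by rewrite monicE PE lead_coefDl // lead_coefXn.
have Psize : size P = d.+1 by rewrite PE size_polyDl // size_polyXn.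
pose ev (f : {poly int}) : K := (map_poly intr f).[y].
have ev_sum (f : {poly int}) k : (size f <= k)%N ->
    ev f = \sum_(i < k) (f`_i)%:~R * y ^+ i.
  move=> fk; rewrite /ev (horner_coef_wide _ (leq_trans (size_poly _ _) fk)).
  by apply: eq_bigr => i _; rewrite coef_map.
(* [P] differs from [q / q`_d], which vanishes at [y], by coefficients less
   than 1. *)
have evP : pabs (ev P) < 1.
  rewrite (ev_sum _ n) ?size_poly //.
  have -> : \sum_(i < n) (P`_i)%:~R * y ^+ i =
      \sum_(i < n) ((P`_i)%:~R * y ^+ i - (q`_d)^-1 * (q`_i * y ^+ i)).
    by rewrite sumrB -mulr_sumr -horner_coef qy mulr0 subr0.
  apply: pabs_sum_lt => // i _.
  rewrite mulrA -mulrBl pabsM pabsX y1 expr1n mulr1 coef_poly ltn_ord.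
  by rewrite pabs_distC mulrC.
have evQ (f : {poly int}) : pabs (ev f) <= 1.
  rewrite (ev_sum _ _ (leqnn _)); apply: pabs_sum_le => // i _.
  by rewrite pabsM pabsX y1 expr1n mulr1 pabs_int_le1.
pose r k := Pdiv.Ring.rmodp ('X^k) P.
have rs k : (size (r k) <= d)%N.
  rewrite -ltnS -Psize Pdiv.Ring.ltn_rmodpN0 //.
  exact: monic_neq0.
have rE k : pabs (y ^+ k - ev (r k)) < 1.
  have -> : y ^+ k = ev 'X^k by rewrite /ev rmorphXn /= map_polyX hornerXn.
  rewrite [in X in pabs (X - _)](Pdiv.RingMonic.rdivp_eq Pmonic 'X^k).
  rewrite /ev rmorphD rmorphM hornerD hornerM addrK -!/(ev _) pabsM.
  by apply: le_lt_trans evP; rewrite ler_piMl ?pabs_ge0.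
pose f (k : 'I_(#|{ffun 'I_d -> 'F_p}|.+1)) : {ffun 'I_d -> 'F_p} :=
  [ffun i => ((r k)`_(i : 'I_d))%:~R].
have /injectivePn[a [b ab fab]] : ~~ injectiveb f.
  by apply/negP => /injectiveP /leq_card; rewrite card_ord ltnn.
have rab : pabs (ev (r a) - ev (r b)) < 1.
  rewrite !(ev_sum _ d) // -sumrB; apply: pabs_sum_lt => // i _.
  rewrite -mulrBl pabsM pabsX y1 expr1n mulr1 -rmorphB.
  have : ((r a)`_i - (r b)`_i)%:~R = 0 :> 'F_p.
    have := congr1 (fun g : {ffun _ -> _} => g i) fab.
    by rewrite !ffunE rmorphB /= => ->; rewrite subrr.
  set t := _ - _ => /eqP t0; have /dvdzP[t' ->] : (p%:Z %| t)%Z.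
    by rewrite (dvdz_pcharf (pchar_Fp p_prime)).
  rewrite rmorphM pabsM (le_lt_trans _ (@pinv_lt1 R p p_prime)) //.
  by rewrite -(pabs_p (s := K)) ler_piMl ?pabs_ge0 ?pabs_int_le1.
have yab : pabs (y ^+ a - y ^+ b) < 1.
  apply: (pabs_dist_lt (ev (r a))) => //.
  by apply: (pabs_dist_lt (ev (r b))) => //; rewrite pabs_distC.
have near1 (u v : nat) : (u < v)%N -> pabs (y ^+ u - y ^+ v) < 1 ->
    exists2 N, (0 < N)%N & pabs (y ^+ N - 1) < 1.
  move=> uv yuv; exists (v - u)%N; first by rewrite subn_gt0.
  have yu : pabs (y ^+ u) = 1 by rewrite pabsX y1 expr1n.
  suff -> : pabs (y ^+ (v - u) - 1) = pabs (y ^+ u - y ^+ v) by [].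
  rewrite pabs_distC -[LHS]mul1r -yu -pabsM mulrBr mulr1 -exprD.
  by rewrite subnKC ?(ltnW uv).
have [|ba|/val_inj aeqb] := ltngtP a b; last by rewrite aeqb eqxx in ab.
  by move=> /near1; apply.
by apply: near1 ba _; rewrite pabs_distC.
Qed.
End ValueGroup.

Section Teichmuller.
Context {R : realType} {p : nat} (p_prime : prime p) {K : padicComplexType R p}.
Variable iota : {rmorphism algC -> K}.
Implicit Types (a x y z t : K) (n : nat).

Lemma pabs_exp_near1 x : pabs x = 1 ->
  exists2 N, (0 < N)%N & pabs (x ^+ N - 1) < 1.
Proof.
move=> x1.
have /closure_pabsP /(_ 1 ltr01)[y yQ xy] :
  closure (@Qpadic_bar K) x by rewrite (@Qpadic_bar_dense R p K).
have y1 : pabs y = 1 by rewrite -x1; apply: pabs_near; rewrite x1.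
have [N N0 yN] := pabs_exp_near1_alg p_prime y yQ y1.
exists N => //; apply: (pabs_dist_lt (y ^+ N)) => //.
by apply: le_lt_trans xy; rewrite pabsX_dist ?x1 ?y1.
Qed.

(** In characteristic [p] the equation [z ^ p = 1] reads [(z - 1) ^ p = 0]. *)
Lemma pabs_pth_root_near1 z : pabs z <= 1 ->
  pabs (z ^+ p - 1) < 1 -> pabs (z - 1) < 1.
Proof.
move=> z1 zp; pose e := z - 1.
have e1 : pabs e <= 1 by apply: pabsB_le; rewrite ?pabs1.
have : pabs (z ^+ p - 1 - e ^+ p) < 1.
  have -> : z = e + 1 by rewrite subrK.
  rewrite exprDn.
  rewrite -(big_mkord xpredT (fun i => e ^+ (p - i) * 1 ^+ i *+ 'C(p, i))).
  rewrite big_nat_recr //= big_ltn ?prime_gt0 // subn0 subnn bin0 binn !expr0.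
  rewrite expr1n !mulr1 !mulr1n addrK [X in pabs X]addrC addKr big_nat.
  apply: pabs_sum_lt => // i ip; rewrite -mulr_natr expr1n mulr1 pabsM.
  apply: (@le_lt_trans _ _ (pabs (p%:R : K))).
    rewrite (le_trans _ (pabs_dvd _ _ (prime_dvd_bin p_prime ip))) //.
    by rewrite ler_piMl ?pabs_ge0 // pabsX exprn_ile1 ?pabs_ge0.
  by rewrite pabs_p pinv_lt1.
rewrite pabs_distC => /pabs_dist_lt => /(_ 0); rewrite !subr0 => /(_ zp).
by rewrite pabsX expr_lt1 ?pabs_ge0 ?prime_gt0.
Qed.

(** The [p]-part of the exponent is removed one factor at a time. *)
Lemma pabs_coprime_exp_near1 x : pabs x = 1 ->
  exists m, [/\ (0 < m)%N, coprime m p & pabs (x ^+ m - 1) < 1].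
Proof.
move=> x1; have [N N0 xN] := pabs_exp_near1 x x1.
have [m pm NE] := pfactor_coprime p_prime N0.
exists m; split; rewrite 1?coprime_sym //.
  by move: N0; rewrite NE muln_gt0 => /andP[].
move: xN; rewrite NE; elim: (logn p N) => [|k IH]; first by rewrite muln1.
rewrite expnSr mulnA exprM => /pabs_pth_root_near1 H; apply: IH; apply: H.
by rewrite pabsX x1 expr1n.
Qed.

(** [x ^ m - 1] is the product of the distances from [x] to the [m]th roots of
    unity, so one of them is less than 1 as soon as [x ^ m] is close to 1. *)
Lemma mu_near x : pabs x = 1 -> exists z : K, mu z /\ pabs (x - z) < 1.
Proof.
move=> x1; have [m [m0 mp xm]] := pabs_coprime_exp_near1 x x1.
have [w wm] := C_prim_root_exists m0.
have vm : m.-primitive_root (iota w) by rewrite fmorph_primitive_root.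
apply: contrapT => Hno.
suff : 1 <= pabs (x ^+ m - 1) by rewrite leNgt xm.
have -> : x ^+ m - 1 = \prod_(0 <= i < m) (x - iota w ^+ i).
  have := congr1 (horner^~ x) (factor_Xn_sub_1 vm).
  rewrite horner_prod hornerD hornerN hornerXn hornerC => <-.
  by apply: eq_bigr => i _; rewrite hornerXsubC.
elim/big_ind: _ => [|y z y1 z1|i _]; first by rewrite pabs1.
  by rewrite pabsM mulr_ege1.
rewrite leNgt; apply/negP => xz; apply: Hno; exists (iota w ^+ i).
split=> //; exists m; split=> //.
by rewrite exprAC (prim_expr_order vm) expr1n.
Qed.

Lemma teich1P x : pabs x = 1 -> mu (teich1 x) /\ pabs (x - teich1 x) < 1.
Proof. by move=> /mu_near; apply: (xgetPex (T := K) 0). Qed.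

Lemma pabs_mu z : mu z -> pabs z = 1.
Proof. by move=> [n [n0 _]]; exact: pabs_unity. Qed.

(** * The projection omegav *)

Lemma pabs_ppow (r : rat) : pabs (ppow iota r) = p%:R `^ (- ratr r).
Proof.
have p0 : 0 < p%:R :> R by rewrite p_gt0.
pose d := `|denq r|%N.
have d0 : (0 < d)%N by rewrite absz_gt0 denq_neq0.
have dR : d%:R != 0 :> R by rewrite pnatr_eq0 -lt0n.
have rootE : pabs (iota (d.-root p%:R)) = p%:R `^ (- d%:R^-1).
  have : pabs (iota (d.-root p%:R)) ^+ d = p%:R `^ (-1).
    by rewrite -pabsX -rmorphXn /= rootCK // rmorph_nat pabs_p powR_inv1 ?ltW.
  rewrite -powR_mulrn ?pabs_ge0 // => /(congr1 (fun u => u `^ d%:R^-1)).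
  by rewrite -!powRrM divff // powRr1 ?pabs_ge0 // mulN1r.
rewrite /ppow /algC_ratpow fmorphXz pabsXz rootE -powR_intmul ?powR_ge0 //.
rewrite -powRrM mulNr mulrC /ratr; congr (_ `^ (- (_ / _))).
by rewrite -[in RHS](absz_denq r).
Qed.

Lemma pabs_div_ppow a : a != 0 -> pabs (a / ppow iota (vp a)) = 1.
Proof.
move=> a0; rewrite pabsM pabsV pabs_ppow -(vpE p_prime) // divff //.
by rewrite gt_eqF // pabs_gt0.
Qed.

Lemma pabs_omegav a : a != 0 -> pabs (omegav iota a) = pabs a.
Proof.
move=> a0; have [/pabs_mu tm _] := teich1P _ (pabs_div_ppow a a0).
by rewrite /omegav pabsM tm mulr1 pabs_ppow -(vpE p_prime).
Qed.

Lemma omegav_neq0 a : a != 0 -> omegav iota a != 0.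
Proof. by move=> a0; rewrite -pabs_gt0 pabs_omegav // pabs_gt0. Qed.

Lemma pabs_angleB1 a : a != 0 -> pabs (angle iota a - 1) < 1.
Proof.
move=> a0; have [/pabs_mu tm at1] := teich1P _ (pabs_div_ppow a a0).
have t0 : teich iota a != 0 by rewrite -pabs_gt0 tm.
have -> : angle iota a - 1 =
    (a / ppow iota (vp a) - teich iota a) / teich iota a.
  by rewrite /angle /omegav invfM mulrA mulrBl divff.
by rewrite pabsM pabsV tm invr1 mulr1.
Qed.

(** Both choices in [omegav a] are made on conditions that hold for all
    elements at distance less than [|a|] of [a] or for none of them. *)
Lemma omegav_near a t : pabs t < pabs a -> omegav iota (a + t) = omegav iota a.
Proof.
move=> ta; have a0 : a != 0.
  by rewrite -pabs_gt0 (le_lt_trans (pabs_ge0 t)).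
have vE : vp (a + t) = vp a by rewrite /vp pabsD_eq.
rewrite /omegav /teich vE; congr (_ * _).
rewrite /teich1; congr xget; apply/seteqP.
have st : pabs ((a + t) / ppow iota (vp a) - a / ppow iota (vp a)) < 1.
  rewrite -mulrBl addrC addKr pabsM pabsV pabs_ppow -(vpE p_prime) //.
  by rewrite ltr_pdivrMr ?mul1r // pabs_gt0.
by split=> z [zm xz]; split=> //; apply: pabs_dist_lt xz => //;
  rewrite pabs_distC.
Qed.
End Teichmuller.

(** * The fermionic integral *)

Section Fermionic.
Context {R : realType} {p : nat} (p_prime : prime p) {K : padicComplexType R p}.
Hypothesis p_odd : odd p.
Implicit Types (f g : K -> K) (C : R) (n N : nat).

(** For [N = p ^ r] these are the sums whose limit is [fermionic_int f]. *)
Definition alt_sum N f : K := \sum_(0 <= k < N) f k%:R * (-1) ^+ k.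

Lemma pabs_alt_sum_le N f C : 0 <= C ->
  (forall k : nat, pabs (f k%:R) <= C) -> pabs (alt_sum N f) <= C.
Proof.
move=> C0 fC; apply: pabs_sum_le => // k _.
by rewrite pabsM pabsX pabsN pabs1 expr1n mulr1.
Qed.

Lemma alt_sumB N f g :
  alt_sum N f - alt_sum N g = alt_sum N (fun t => f t - g t).
Proof. by rewrite /alt_sum -sumrB; apply: eq_bigr => k _; rewrite mulrBl. Qed.

Lemma alt_sum_cat n N f : alt_sum (n + N) f =
  alt_sum n f + \sum_(0 <= k < N) f (n + k)%:R * (-1) ^+ (n + k).
Proof.
rewrite /alt_sum (@big_cat_nat _ _ _ n) ?leq_addr //=; congr (_ + _).
rewrite -{1}[n]add0n big_addn addKn.
by apply: eq_bigr => k _; rewrite addnC.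
Qed.

Lemma alt_sum_shift N f : odd N ->
  alt_sum N f + alt_sum N (fun t => f (t + 1)) = f 0 + f N%:R.
Proof.
move=> oN; suff -> : alt_sum N f + alt_sum N (fun t => f (t + 1)) =
    f 0 - (-1) ^+ N * f N%:R by rewrite -signr_odd oN expr1 mulN1r opprK.
elim: N {oN} => [|N IH].
  by rewrite /alt_sum !big_geq // expr0 mul1r subrr addr0.
rewrite /alt_sum !big_nat_recr //= addrACA -!/(alt_sum _ _) IH.
by rewrite natr1 exprS; ring.
Qed.

Lemma odd_expp r : odd (p ^ r).
Proof. by rewrite oddX p_odd orbT. Qed.

(** Two consecutive blocks of odd length [q] enter an alternating sum with
    opposite signs. *)
Lemma pabs_alt_sum_blocks f q j : odd q ->
  (forall k l : nat, pabs (f k%:R - f l%:R) <= pabs (k%:R - l%:R : K)) ->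
  pabs (alt_sum (q + j.*2 * q) f - alt_sum q f) <= pabs (q%:R : K).
Proof.
move=> oq fL; elim: j => [|j IH].
  by rewrite mul0n addn0 subrr pabs0 pabs_ge0.
set n := (q + j.*2 * q)%N in IH *.
have -> : (q + j.+1.*2 * q)%N = (n + q + q)%N.
  by rewrite doubleS !mulSn /n; lia.
clearbody n.
apply: (pabs_dist_le (alt_sum n f)) => //.
rewrite !alt_sum_cat -[X in X - _]addrA [X in pabs X]addrC addKr -big_split /=.
apply: pabs_sum_le => [|k _]; first exact: pabs_ge0.
have -> : f (n + k)%:R * (-1) ^+ (n + k) +
    f (n + q + k)%:R * (-1) ^+ (n + q + k) =
    (f (n + k)%:R - f (n + q + k)%:R) * (-1) ^+ (n + k).
  rewrite [in X in _ + X]addnAC [in X in _ + X]exprD -[(-1) ^+ q]signr_odd oq.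
  by rewrite expr1 mulrN1 mulrN mulrBl [(n + k + q)%N]addnAC.
rewrite pabsM pabsX pabsN pabs1 expr1n mulr1 (le_trans (fL _ _)) //.
by rewrite addnAC [(n + k + q)%:R]natrD opprD addrA subrr add0r pabsN.
Qed.

Lemma pabs_expp_small (e : R) : 0 < e ->
  exists N, forall r, (N <= r)%N -> pabs ((p ^ r)%:R : K) < e.
Proof.
move=> e0; have [N NE] := ppow_small p_prime e e0.
by exists N => r /NE; rewrite pabs_pX.
Qed.

(** Passing from [p ^ r] to [p ^ r.+1] adds pairs of blocks that cancel up to
    [|p ^ r|]. *)
Lemma fermionic_cvg f :
  (forall k l : nat, pabs (f k%:R - f l%:R) <= pabs (k%:R - l%:R : K)) ->
  (fun r => alt_sum (p ^ r) f) @ \oo --> fermionic_int f.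
Proof.
move=> fL; have [l fl] : exists l : K, (fun r => alt_sum (p ^ r) f) @ \oo --> l.
  apply: pabs_complete => e e0; have [N NE] := pabs_expp_small e e0.
  exists N => r /NE; apply: le_lt_trans.
  (* A range of length [p ^ r.+1] is one of length [p ^ r] followed by [p./2]
     pairs of blocks. *)
  have -> : (p ^ r.+1 = p ^ r + p./2.*2 * p ^ r)%N.
    rewrite expnS -mulSn; congr (_ * _)%N.
    by have := odd_double_half p; rewrite p_odd add1n => ->.
  exact: pabs_alt_sum_blocks (odd_expp r) fL.
by rewrite /fermionic_int (plim_cvg _ _ fl).
Qed.

(** The sum of the two alternating sums telescopes to [f 0 + f (p ^ r)], and
    [p ^ r] tends to 0. *)
Lemma fermionic_shift f :
  (forall k : nat, pabs (f k%:R - f 0) <= pabs (k%:R : K)) ->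
  (fun r => alt_sum (p ^ r) f + alt_sum (p ^ r) (fun t => f (t + 1))) @ \oo
    --> f 0 *+ 2.
Proof.
move=> fL; apply/cvg_pabsP => e e0; have [N NE] := pabs_expp_small e e0.
exists N => r /NE; apply: le_lt_trans.
by rewrite alt_sum_shift ?odd_expp // mulr2n opprD addrACA subrr add0r.
Qed.
End Fermionic.

(** * Powers of angles and the coefficients of the operator *)

Section AnglePowers.
Context {R : realType} {p : nat} (p_prime : prime p) {K : padicComplexType R p}.
Variable iota : {rmorphism algC -> K}.
Implicit Types (a b s t u : K) (n : nat).

Lemma anglepow_dist b t u : nat_approximable u -> 1 < pabs b -> pabs t <= 1 ->
  pabs (anglepow iota (b + t) u - anglepow iota b u) <= pabs t.
Proof.
move=> uN b1 t1; have tb : pabs t < pabs b by exact: le_lt_trans b1.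
have b0 : b != 0 by rewrite -pabs_gt0 (lt_trans ltr01).
have bt0 : b + t != 0 by rewrite -pabs_gt0 pabsD_eq // (lt_trans ltr01).
rewrite (le_trans (binser_dist p_prime _ _ _ uN _ _)) ?pabs_angleB1 //.
rewrite opprB subrKA /angle omegav_near // -mulrBl [X in X / _]addrC addKr.
rewrite pabsM pabsV pabs_omegav // ler_piMr ?pabs_ge0 //.
by rewrite invf_le1 ?ltW // (lt_trans ltr01).
Qed.

Lemma anglepow_le1 b u : nat_approximable u -> b != 0 ->
  pabs (anglepow iota b u) <= 1.
Proof. by move=> uN b0; apply: binser_le1 => //; exact: pabs_angleB1. Qed.

Lemma anglepow_subn b u n : nat_approximable u ->
  nat_approximable (u - n%:R) -> b != 0 ->
  anglepow iota b (u - n%:R) = anglepow iota b u * (omegav iota b / b) ^+ n.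
Proof.
move=> uN unN b0; rewrite -{2}(subrK n%:R u).
rewrite [X in _ = X * _]binserD_nat ?subrK ?pabs_angleB1 //.
have ang0 : angle iota b != 0.
  rewrite -pabs_gt0 pabsM pabsV pabs_omegav // divff ?ltr01 //.
  by rewrite gt_eqF ?pabs_gt0.
have -> : omegav iota b / b = (angle iota b)^-1 by rewrite /angle invf_div.
by rewrite [1 + _]addrC subrK -mulrA -exprMn divff // expr1n mulr1.
Qed.

(** [<b> (1 - 1 / b) = <b - 1>] because [b] and [b - 1] have the same
    [omegav]. *)
Lemma anglepow_sub1 b u : nat_approximable u -> 1 < pabs b ->
  anglepow iota b u * binser u (- b^-1) = anglepow iota (b - 1) u.
Proof.
move=> uN b1; have b0 : b != 0 by rewrite -pabs_gt0 (lt_trans ltr01).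
have bE : pabs (b - 1) = pabs b by rewrite pabsD_eq // pabsN pabs1.
have b10 : b - 1 != 0 by rewrite -pabs_gt0 bE (lt_trans ltr01).
apply: binserM => //; rewrite ?pabs_angleB1 //.
  by rewrite pabsN pabsV invf_lt1 // (lt_trans ltr01).
rewrite ![1 + (_ - 1)]addrC !subrK /angle omegav_near ?pabsN ?pabs1 //.
by rewrite mulrAC mulrBr mulr1 divff.
Qed.

(** The rising product in [Pcoef] is the falling product of the binomial
    coefficient up to signs. The term at [n = 0] is the excess of the factor 2
    in the coefficient of index 0. *)
Lemma Pcoef_binom a n s : s != 1 -> a != 0 ->
  (s - 1) * Pcoef iota a n s =
  (n == 0%N)%:R + binomK (1 - s) n * (- (omegav iota a)^-1) ^+ n.
Proof.
move=> s1 a0; have s10 : s - 1 != 0 by rewrite subr_eq0.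
have prodN m : \prod_(i < m) (1 - s - i%:R) =
    (-1) ^+ m * \prod_(0 <= j < m) (s - 1 + j%:R) :> K.
  elim: m => [|m IH]; first by rewrite big_ord0 big_geq // mulr1.
  by rewrite big_ord_recr big_nat_recr //= IH exprS; ring.
have PnE m : Pcoef iota a m.+1 s =
    (m.+1`!%:R * omegav iota a ^+ m.+1)^-1 *
    \prod_(1 <= j < m.+1) (s - 1 + j%:R).
  case: m => // /=.
  by rewrite big_geq // expr1 mul1r mulr1.
case: n => [|n].
  by rewrite /binomK big_ord0 expr0 mulr1 divr1 mulrC divfK.
rewrite PnE /binomK prodN (big_ltn (ltn0Sn n)) /= addr0 add0r.
rewrite [(- (omegav _ _)^-1) ^+ _]exprNn exprVn invfM.
set w := _^-1; set v := _^-1; set P := \prod_(_ <= _ < _) _.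
have sg : (-1) ^+ n.+1 * (-1) ^+ n.+1 = 1 :> K.
  by rewrite -exprMn mulrNN mulr1 expr1n.
transitivity ((-1) ^+ n.+1 * (-1) ^+ n.+1 * ((s - 1) * (w * v * P))).
  by rewrite sg mul1r.
by ring.
Qed.
End AnglePowers.

(** * The differential equation *)

Section DifferenceEquation.
Context {R : realType} {p : nat} (p_prime : prime p) {K : padicComplexType R p}.
Variable iota : {rmorphism algC -> K}.
Hypothesis p_odd : odd p.
Variables (s a : K).
Hypotheses (sZp : Zpadic s) (s_neq1 : s != 1) (a_gt1 : 1 < pabs a).
Implicit Types (t : K) (n N : nat).

Lemma exponent_nat_approximable n : nat_approximable (1 - (s + n%:R)).
Proof.
have -> : 1 - (s + n%:R) = (1 - n%:Z)%:~R - s.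
  by rewrite rmorphB /= opprD addrA addrAC.
exact/nat_approximable_shift/Zpadic_nat_approximable.
Qed.

Lemma exponent0_nat_approximable : nat_approximable (1 - s).
Proof. by rewrite -[s]addr0; exact: (exponent_nat_approximable 0). Qed.

Lemma pabs_aD t : pabs t <= 1 -> pabs (a + t) = pabs a.
Proof. by move=> t1; rewrite pabsD_eq // (le_lt_trans t1). Qed.

Lemma aD_neq0 t : pabs t <= 1 -> a + t != 0.
Proof. by move=> t1; rewrite -pabs_gt0 pabs_aD // (lt_trans ltr01). Qed.

Lemma anglepow_lipschitz u t t' : nat_approximable u ->
  pabs t <= 1 -> pabs t' <= 1 ->
  pabs (anglepow iota (a + t) u - anglepow iota (a + t') u) <= pabs (t - t').
Proof.
move=> uN t1 t1'; have -> : a + t = a + t' + (t - t').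
  by rewrite addrA addrAC addrK.
by apply: anglepow_dist; rewrite ?pabs_aD // pabsB_le.
Qed.

Lemma zetaE_cvg n :
  (fun r => alt_sum (p ^ r) (fun t => anglepow iota (a + t) (1 - (s + n%:R))))
    @ \oo --> zetaE iota (s + n%:R) a.
Proof.
apply: fermionic_cvg => // k l.
by apply: anglepow_lipschitz; rewrite ?pabs_nat_le1 //;
   exact: exponent_nat_approximable.
Qed.

Let f t := anglepow iota (a + t) (1 - s).
Let c n := binomK (1 - s) n * (- (omegav iota a)^-1) ^+ n.
Let F N t :=
  \sum_(0 <= n < N) c n * anglepow iota (a + t) (1 - (s + n%:R)).

(** The sum [F N] is [f t] times a partial sum of the binomial series of
    [(1 - 1 / (a + t)) ^ (1 - s)]. *)
Lemma truncation_error N t : pabs t <= 1 ->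
  pabs (F N t - f (t - 1)) <= (pabs a)^-1 ^+ N.
Proof.
move=> t1; have at0 := aD_neq0 _ t1; have sN := exponent0_nat_approximable.
have y1 : pabs (- (a + t)^-1) < 1.
  by rewrite pabsN pabsV pabs_aD // invf_lt1 // (lt_trans ltr01).
have -> : F N t =
    f t * \sum_(0 <= n < N) binomK (1 - s) n * (- (a + t)^-1) ^+ n.
  rewrite mulr_sumr; apply: eq_bigr => n _.
  have := exponent_nat_approximable n; rewrite opprD addrA => uN.
  rewrite anglepow_subn // omegav_near ?(le_lt_trans t1) // mulrCA /c.
  have w0 : omegav iota a != 0 by rewrite -[a]addr0 omegav_neq0 ?aD_neq0 ?pabs0.
  by rewrite -mulrA -[X in _ * (_ * X)]exprMn mulNr mulKf.
have -> : f (t - 1) = f t * binser (1 - s) (- (a + t)^-1).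
  by rewrite /f addrA anglepow_sub1 // pabs_aD.
rewrite -mulrBr pabsM (le_trans _ (_ : pabs (- (a + t)^-1) ^+ N <= _)) //.
  rewrite pabs_distC (le_trans _ (binser_tail p_prime _ _ _ sN y1)) //.
  by rewrite ler_piMl ?pabs_ge0 // anglepow_le1.
by rewrite pabsN pabsV pabs_aD.
Qed.

Lemma alt_sum_F_cvg N :
  (fun r => alt_sum (p ^ r) (F N)) @ \oo -->
  \sum_(0 <= n < N) c n * zetaE iota (s + n%:R) a.
Proof.
rewrite (_ : (fun r => _) = fun r => \sum_(0 <= n < N) c n *
    alt_sum (p ^ r) (fun t => anglepow iota (a + t) (1 - (s + n%:R)))).
  by apply: cvg_pabs_sum => n; apply: cvg_pabsMl; exact: zetaE_cvg.
apply/funext => r; rewrite /alt_sum /F.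
under eq_bigr do rewrite mulr_suml.
rewrite exchange_big /=; apply: eq_bigr => n _.
by rewrite mulr_sumr; apply: eq_bigr => k _; rewrite mulrA.
Qed.

(** The weighted sum of zeta values is the integral of [F N + f]. With
    [f (t - 1)] in the place of [F N t] this integral would be [2 f (- 1)]. *)
Lemma zeta_sum_error N :
  pabs (\sum_(0 <= n < N) c n * zetaE iota (s + n%:R) a + zetaE iota s a
        - f (-1) *+ 2) <= (pabs a)^-1 ^+ N.
Proof.
have sN := exponent0_nat_approximable.
pose g t := f (t - 1).
have gE : (fun t => g (t + 1)) = f by apply/funext => t; rewrite /g addrK.
have g0 : g 0 = f (-1) by rewrite /g add0r.
have nat1 (k : nat) : pabs (k%:R - 1 : K) <= 1.
  by rewrite pabsB_le ?pabs_nat_le1 ?pabs1.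
have := zetaE_cvg 0; rewrite addr0 -/f => fz.
have gL (k : nat) : pabs (g k%:R - g 0) <= pabs (k%:R : K).
  have kE : k%:R - 1 - (0 - 1) = k%:R :> K by rewrite opprB addrA subrK subr0.
  rewrite -[X in _ <= pabs X]kE.
  exact: anglepow_lipschitz sN (nat1 k) (nat1 0%N).
have := fermionic_shift p_prime p_odd g gL; rewrite gE g0 => gcvg.
have lim := cvg_pabsB _ _ _ _ (cvg_pabsD _ _ _ _ (alt_sum_F_cvg N) fz) gcvg.
apply: (cvg_pabs_le _ _ _ 0 lim) => r _.
rewrite opprD addrACA subrr addr0 alt_sumB.
apply: pabs_alt_sum_le => [|k]; first by rewrite exprn_ge0 ?invr_ge0 ?pabs_ge0.
by apply: truncation_error; exact: pabs_nat_le1.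
Qed.

Let h (u : K) := zetaE iota u a - anglepow iota a (1 - u).

Lemma Lop_term n : (s - 1) * Lop iota a n h s =
  (n == 0%N)%:R * (zetaE iota s a - f 0) +
  (c n * zetaE iota (s + n%:R) a -
   c n * anglepow iota (a + 0) (1 - (s + n%:R))).
Proof.
have a0 : a != 0 by rewrite -[a]addr0 aD_neq0 ?pabs0.
rewrite /Lop /expD mulrA Pcoef_binom // mulrDl -mulrBr /h /f addr0.
by congr (_ + _); case: n => [|n]; rewrite ?mul0r // !addr0.
Qed.

Lemma Tp_partial_sum N :
  (s - 1) * series (fun n => Lop iota a n h s) N.+1 =
  \sum_(0 <= n < N.+1) c n * zetaE iota (s + n%:R) a + zetaE iota s a
  - (F N.+1 0 + f 0).
Proof.
rewrite /series /= mulr_sumr (eq_bigr _ (fun n _ => Lop_term n)).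
rewrite big_split /= sumrB.
rewrite [X in X + _]big_nat_recl // [X in _ + X + _]big1 => [|n _]; last first.
  by rewrite mul0r.
rewrite mul1r addr0 -/(F N.+1 0) opprD [LHS]addrC addrACA; congr (_ + _).
Qed.

Lemma Tp_error N :
  pabs ((s - 1) * series (fun n => Lop iota a n h s) N.+1
        - (f (-1) - f 0)) <= (pabs a)^-1 ^+ N.+1.
Proof.
rewrite Tp_partial_sum; set Z := \sum_(_ <= _ < _) _.
have regroup (z x F0 f0 : K) :
  Z + z - (F0 + f0) - (x - f0) = (Z + z - x *+ 2) - (F0 - x) by ring.
rewrite regroup.
apply: pabsB_le; first exact: zeta_sum_error.
by have := truncation_error N.+1 0; rewrite pabs0 ler01 sub0r; apply.
Qed.

Lemma Tp_cvg : Tp_eq iota a h s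
  ((s - 1)^-1 * (anglepow iota (a - 1) (1 - s) - anglepow iota a (1 - s))).
Proof.
have s10 : s - 1 != 0 by rewrite subr_eq0.
rewrite /Tp_eq (_ : series _ = fun N =>
    (s - 1)^-1 * ((s - 1) * series (fun n => Lop iota a n h s) N)); last first.
  by apply/funext => N; rewrite mulKf.
apply: cvg_pabsMl; apply/cvg_pabsP => e e0.
have ia1 : (pabs a)^-1 < 1 by rewrite invf_lt1 // (lt_trans ltr01).
have ia0 : 0 <= (pabs a)^-1 by rewrite invr_ge0 pabs_ge0.
have [M ME] := geometric_small _ _ ia0 ia1 e0.
exists M.+1 => -[//|N]; rewrite ltnS => MN.
have -> : anglepow iota a (1 - s) = f 0 by rewrite /f addr0.
by apply: le_lt_trans (Tp_error N) (ME _ _); exact: leqW.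
Qed.
End DifferenceEquation.

Theorem theorem3p5 (R : realType) (p : nat) (p_prime : prime p) (p_odd : odd p)
    (K : padicComplexType R p) (iota : {rmorphism algC -> K})
    (s a : K) (sZp : Zpadic s) (s_neq1 : s <> 1) (a_gt1 : 1 < pabs a) :
  Tp_eq iota a (fun u : K => zetaE iota u a - anglepow iota a (1 - u)) s
    ((s - 1)^-1 *
       (anglepow iota (a - 1) (1 - s) - anglepow iota a (1 - s))).
Proof.
exact: (Tp_cvg p_prime iota p_odd s a sZp (introN eqP s_neq1) a_gt1).
Qed.
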